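(* Let $n \ge 1$ be an integer and let $A > 0$ be a real constant. Let $H_1,\ldots,H_n$ be positive integers with $\max_{j=1,\ldots,n} H_j = H$, let $B_1,\ldots,B_n$ be arbitrary integers, and consider the boxes $$\mathfrak{B}_0 = [1,H_1]\times\cdots\times[1,H_n], \qquad \mathfrak{B} = [B_1+1,B_1+H_1]\times\cdots\times[B_n+1,B_n+H_n].$$ Then for any vector $\mathbf{a} = (a_0,a_1,\ldots,a_n)\in\mathbb{Z}^{n+1}$ with $1 \le |a_i| \le \exp(H^{A})$ for $i=1,\ldots,n$ (and with no restriction on the integer $a_0$), the number $N_n(\mathbf{a};\mathfrak{B}_0,\mathfrak{B})$ of integer solutions to $$\sum_{j=1}^n a_j\frac{s_j}{r_j} = a_0, \qquad (r_1,\ldots,r_n)\in\mathfrak{B}_0\cap\mathbb{Z}^n,\quad (s_1,\ldots,s_n)\in\mathfrak{B}\cap\mathbb{Z}^n,$$ satisfies $$N_n(\mathbf{a};\mathfrak{B}_0,\mathfrak{B}) \le H_1\cdots H_n\,(\log H)^{2^n-1+o(1)}$$ as $H\to\infty$.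
   Context: A solution is a $2n$-tuple of integers $(r_1,\ldots,r_n,s_1,\ldots,s_n)$; no coprimality between $r_j$ and $s_j$ is required. The term $o(1)$ denotes a quantity tending to $0$ as $H\to\infty$, at a rate depending only on $n$ and $A$ (so uniformly in the $H_j$ with $\max_j H_j = H$, in the $B_j$, and in $\mathbf{a}$). The bound $|a_i|\le\exp(H^{A})$ with a fixed constant $A$ is the meaning of the condition $|a_i| \le \exp(H^{O(1)})$. *)

(* Defs.v *)
From HB Require Import structures.
From mathcomp Require Import all_boot all_order all_algebra finmap.
From mathcomp Require Import all_classical all_reals all_analysis.
Import Order.TTheory GRing.Theory Num.Theory.
Import numFieldNormedType.Exports.

Set Implicit Arguments.
Unset Strict Implicit.
Unset Printing Implicit Defensive.

Local Open Scope classical_set_scope.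
Local Open Scope ring_scope.

Definition int_box (n : nat) (lo hi : 'I_n -> int) : set 'rV[int]_n :=
  [set x | forall j, lo j <= x 0 j <= hi j].

(* The equation is read in rat; x / 0 = 0 there, so the boxes used for the
   denominators are expected not to meet any hyperplane r_j = 0. *)
Definition frac_solutions (n : nat) (a : 'rV[int]_n.+1)
    (B0 B : set 'rV[int]_n) : set ('rV[int]_n * 'rV[int]_n) :=
  [set rs | B0 rs.1 /\ B rs.2 /\
    \sum_(j < n) (a 0 (lift ord0 j))%:~R * ((rs.2 0 j)%:~R / (rs.1 0 j)%:~R)
      = (a 0 ord0)%:~R :> rat].

(* fset_set sends an infinite set to fset0; frac_solutions_finite rules this
   case out for boxes. *)
Definition num_frac_solutions (n : nat) (a : 'rV[int]_n.+1)
    (B0 B : set 'rV[int]_n) : nat :=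
  #|` fset_set (frac_solutions a B0 B)|%fset.

Lemma int_box_finite (n : nat) (lo hi : 'I_n -> int) :
  finite_set (int_box lo hi).
Proof.
pose M := (\max_(j < n) `|(hi j - lo j)%R|)%N.
pose f (x : {ffun 'I_n -> 'I_M.+1}) : 'rV[int]_n :=
  \row_j (lo j + (x j : nat)%:Z).
apply: (@sub_finite_set _ _ (f @` setT)); last first.
  by apply: finite_image; exact: finite_finset.
move=> x xb; exists [ffun j => inord `|(x 0 j - lo j)%R|%N] => //.
apply/rowP => j; rewrite mxE ffunE inordK.
  have /andP[lx _] := xb j.
  by rewrite gez0_abs ?subr_ge0// addrC subrK.
rewrite ltnS; apply: leq_trans (leq_bigmax j) => /=.
have /andP[lx xh] := xb j.
by rewrite -lez_nat !gez0_abs ?subr_ge0 ?lerB// (le_trans lx).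
Qed.

Lemma frac_solutions_finite (n : nat) (a : 'rV[int]_n.+1)
    (lo0 hi0 lo hi : 'I_n -> int) :
  finite_set (frac_solutions a (int_box lo0 hi0) (int_box lo hi)).
Proof.
apply: sub_finite_set (finite_setX (int_box_finite lo0 hi0)
                                   (int_box_finite lo hi)).
by move=> rs [? [? _]].
Qed.

(* Main.v *)
Require Import Defs.
From HB Require Import structures.
From mathcomp Require Import all_boot all_order all_algebra finmap.
From mathcomp Require Import all_classical all_reals all_analysis.
From mathcomp Require Import ring lra zify.
Import Order.TTheory GRing.Theory Num.Theory.
Import numFieldNormedType.Exports.

(** The proof passes from the solutions to a dual object whose size is a moment
of a divisor function. Write [H_j] for the side lengths, [H] for their maximum
and [E] for the harmonic sum up to [H].

Fix a prime [p] that exceeds [H ^ n] and divides no [a_j] with [j >= 1]; the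
equation is then only used modulo [p]. For fixed denominators [r], put
[b_j = a_j / r_j] in the field with [p] elements. Two solutions [s], [s'] differ
by a vector [t] with [|t_j| < H_j] and [t . b = 0]. Many such short vectors
orthogonal to [b] force many multiples of [b] to be short: if there are [m] of
them, then at least about [m p / (H_1 ... H_n)] scalars [k] are such that every
[k b_j] is the residue of an integer of size at most [p / (8 n H_j)]. This
transference principle is [transference], applied to boxes in
[card_numerators_le_dual]. It is Fourier duality between the lattice of the [t]
and the line spanned by [b], made elementary by a second moment of the cosine
sum [x |-> \sum_t cos (2 pi (t . x) / p)].

Now sum over [r]. The condition on [k b_j] reads [k a_j = r_j y] with [y] small,
and the product [r_j y] has absolute value below [p], so [r_j] divides the least
nonnegative residue of [k a_j] or that of its opposite. For a given [k] the number
of admissible [r] is thus at most a product over [j] of truncated divisor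
functions at [k a_j], and this product is at most the sum of their [n]-th
powers. Since [k |-> k a_j] permutes the residues, the vector [a] disappears and
there remains [\sum_(x < p) tau x ^ n], where [tau x] is the number of divisors
of [x] not exceeding [H].

Because [tau] is submultiplicative, expanding one factor [tau x] at a time and
inducting on the exponent bounds this moment by [p E ^ (2 ^ n - 1)]
([ndivisors_upto_moment]); the exponent comes from [1 + 2 + ... + 2 ^ (n - 1)].
Altogether the number of solutions is at most [c H_1 ... H_n E ^ (2 ^ n - 1)]
with [c] depending on [n] only ([card_solutions_le]). Finally
[E <= 1 + ln H <= 2 ln H], and a constant [C] equals
[(ln H) ^ (ln C / ln (ln H))], an exponent that tends to [0]. *)

Set Implicit Arguments.
Unset Strict Implicit.
Unset Printing Implicit Defensive.

Local Open Scope ring_scope.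

(** * Moments of a truncated divisor function *)

Definition ndivisors_upto (H x : nat) : nat :=
  size [seq r <- index_iota 1 H.+1 | r %| x]%N.

Definition harmonic (R : fieldType) (H : nat) : R :=
  \sum_(1 <= r < H.+1) r%:R^-1.

(** A divisor [r] of [a * b] splits as [gcd r a] times a divisor of [b], and both
factors respect the bound [H] because [r] does. *)
Lemma ndivisors_uptoM H a b :
  (ndivisors_upto H (a * b) <= ndivisors_upto H a * ndivisors_upto H b)%N.
Proof.
rewrite /ndivisors_upto -(size_allpairs muln).
apply: uniq_leq_size; first by rewrite filter_uniq// iota_uniq.
move=> r; rewrite mem_filter mem_index_iota ltnS => /andP[rab /andP[r0 rH]].
have g0 : (0 < gcdn r a)%N by rewrite gcdn_gt0 r0.
have gr : (gcdn r a %| r)%N by rewrite dvdn_gcdl.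
apply/allpairsP; exists (gcdn r a, r %/ gcdn r a)%N; split => /=.
- rewrite mem_filter dvdn_gcdr mem_index_iota g0 ltnS.
  by rewrite (leq_trans _ rH)// dvdn_leq.
- rewrite mem_filter mem_index_iota ltnS (leq_trans (leq_div _ _) rH).
  rewrite divn_gt0// dvdn_leq// !andbT.
  have co : coprime (r %/ gcdn r a) (a %/ gcdn r a).
    by rewrite /coprime -(eqn_pmul2r g0) mul1n muln_gcdl !divnK ?dvdn_gcdr.
  rewrite -(Gauss_dvdr _ co) -(dvdn_pmul2l g0) mulnC divnK//.
  by rewrite mulnA [X in (_ %| X * _)%N]mulnC divnK ?dvdn_gcdr.
- by rewrite mulnC divnK.
Qed.

Lemma big_multiples (R : nmodType) (F : nat -> R) (r X : nat) : (0 < r)%N ->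
  \sum_(1 <= x < X.+1 | (r %| x)%N) F x
  = \sum_(1 <= y < (X %/ r).+1) F (r * y)%N.
Proof.
move=> r0; elim: X => [|X IH]; first by rewrite div0n !big_nil.
rewrite big_mkcond big_nat_recr//= -big_mkcond/= IH divnS//.
case: ifPn => [rX|_] /=; last by rewrite addr0.
have -> : X.+1 = (r * (X %/ r).+1)%N by rewrite -{1}(divnK rX) divnS// rX mulnC.
by rewrite [RHS]big_nat_recr.
Qed.

(** Each factor [ndivisors_upto H x] counts the [r] with [x = r * y]; summing over
[r] first is what lets the moments below be computed recursively. *)
Lemma sum_mul_ndivisors (R : pzSemiRingType) (F : nat -> R) (H X : nat) :
  \sum_(1 <= x < X.+1) F x * (ndivisors_upto H x)%:R
  = \sum_(1 <= r < H.+1) \sum_(1 <= y < (X %/ r).+1) F (r * y)%N.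
Proof.
under eq_bigr do
  rewrite /ndivisors_upto -sum1_size natr_sum big_filter mulr_sumr big_mkcond/=.
rewrite exchange_big/=; apply: eq_big_nat => r /andP[r0 _].
rewrite -big_multiples// [RHS]big_mkcond/=.
by apply: eq_bigr => x _; rewrite mulr1.
Qed.

Section moments.
Variables (R : realFieldType) (H : nat).
Local Notation tau := (ndivisors_upto H).
Local Notation E := (harmonic R H).

Lemma harmonic_ge0 : 0 <= E.
Proof. by apply: sumr_ge0 => r _; rewrite invr_ge0 ler0n. Qed.

Lemma ndivisors_uptoMX k r y :
  ((tau (r * y))%:R : R) ^+ k <= (tau r)%:R ^+ k * (tau y)%:R ^+ k.
Proof.
by rewrite -exprMn lerXn2r ?nnegrE ?mulr_ge0// -natrM ler_nat ndivisors_uptoM.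
Qed.

(** With weights [1 / x] the recursion squares: expanding one factor and
separating [r] from [y] by submultiplicativity bounds the moment of order
[k + 1] by the square of the moment of order [k]. *)
Lemma ndivisors_upto_log_moment k :
  \sum_(1 <= x < H.+1) (tau x)%:R ^+ k / x%:R <= E ^+ (2 ^ k).
Proof.
elim: k => [|k IH].
  by rewrite expr1 /harmonic; under eq_bigr do rewrite expr0 mul1r.
rewrite expnS mulnC exprM expr2.
set S := \sum_(1 <= x < H.+1) _ in IH.
have S0 : 0 <= S.
  by apply: sumr_ge0 => x _; rewrite mulr_ge0 ?invr_ge0 ?exprn_ge0.
apply: (@le_trans _ _ (S * S)); last by rewrite ler_pM.
under eq_bigr do rewrite exprSr mulrAC.
rewrite (sum_mul_ndivisors (fun x => (tau x)%:R ^+ k / x%:R)) mulr_suml.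
apply: ler_sum => r _; rewrite mulr_sumr.
rewrite [leRHS](@big_cat_nat _ _ _ (H %/ r).+1)//=; last first.
  by rewrite ltnS leq_div.
rewrite -[leLHS]addr0 lerD//; last first.
  by apply: sumr_ge0 => y _; rewrite !mulr_ge0 ?invr_ge0 ?exprn_ge0.
apply: ler_sum => y _.
rewrite natrM invfM mulrACA ler_wpM2r ?mulr_ge0 ?invr_ge0//.
exact: ndivisors_uptoMX.
Qed.

(** One step of the recursion costs a factor [E ^ (2 ^ k)], the logarithmic moment
of order [k], so the exponents add up to [1 + 2 + ... + 2 ^ (k - 1)]. The bound
holds for all [X] at once, since the induction applies it at [X %/ r]. *)
Lemma ndivisors_upto_moment k X :
  \sum_(1 <= x < X.+1) ((tau x)%:R : R) ^+ k <= X%:R * E ^+ (2 ^ k - 1).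
Proof.
elim: k X => [|k IH] X.
  rewrite expr0 mulr1; under eq_bigr do rewrite expr0.
  by rewrite sumr_const_nat subn1.
under eq_bigr do rewrite exprSr.
rewrite (sum_mul_ndivisors (fun x => (tau x)%:R ^+ k)).
apply: (@le_trans _ _ (\sum_(1 <= r < H.+1)
   (tau r)%:R ^+ k / r%:R * (X%:R * E ^+ (2 ^ k - 1)))).
  rewrite big_nat [leRHS]big_nat; apply: ler_sum => r /andP[r0 _].
  apply: (@le_trans _ _ ((tau r)%:R ^+ k *
      \sum_(1 <= y < (X %/ r).+1) (tau y)%:R ^+ k)).
    by rewrite mulr_sumr; apply: ler_sum => y _; exact: ndivisors_uptoMX.
  rewrite -mulrA ler_wpM2l ?exprn_ge0// (le_trans (IH _))// mulrA ler_wpM2r//.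
    by rewrite exprn_ge0// harmonic_ge0.
  by rewrite mulrC ler_pdivlMr ?ltr0n// -natrM ler_nat leq_trunc_div.
rewrite -mulr_suml mulrCA ler_wpM2l//.
rewrite expnS mul2n -addnn -addnBA ?expn_gt0// exprD.
by rewrite ler_wpM2r ?ndivisors_upto_log_moment ?exprn_ge0 ?harmonic_ge0.
Qed.
End moments.

(** * Transference between short orthogonal vectors and short multiples *)

Definition dot (F : pzRingType) (n : nat) (t x : 'rV[F]_n) : F :=
  \sum_j t 0 j * x 0 j.

Lemma dotDl (F : pzRingType) n (t u x : 'rV[F]_n) :
  dot (t + u) x = dot t x + dot u x.
Proof. by rewrite -big_split; apply: eq_bigr => j _; rewrite mxE mulrDl. Qed.

Lemma dotBl (F : pzRingType) n (t u x : 'rV[F]_n) :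
  dot (t - u) x = dot t x - dot u x.
Proof.
by rewrite -sumrB; apply: eq_bigr => j _; rewrite !mxE mulrBl.
Qed.

Lemma dotDZr (F : comPzRingType) n (t x y : 'rV[F]_n) k :
  dot t (x + k *: y) = dot t x + k * dot t y.
Proof.
rewrite /dot mulr_sumr -big_split; apply: eq_bigr => j _.
by rewrite !mxE mulrDr mulrCA.
Qed.

(** The hypotheses on [c] are d'Alembert's functional equation and
non-triviality: [c] behaves as the real part of a nontrivial additive character
of [F]. *)
Section transference.
Variables (R : realFieldType) (F : finFieldType) (n : nat) (c : F -> R).
Hypothesis cDB : forall u v, c (u + v) + c (u - v) = 2 * (c u * c v).
Hypotheses (c0 : c 0 = 1) (c1 : c 1 != 1).
Local Notation X := 'rV[F]_n.

(** Shifting [x] along a vector [e] with [t . e = 1] or [-1] does not change the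
sum, and averaging both shifts multiplies it by [c 1], which differs from 1. *)
Lemma sum_cosine_dot (t : X) :
  \sum_(x : X) c (dot t x) = if t == 0 then (#|X|)%:R else 0.
Proof.
case: eqP => [->|/eqP t0].
  rewrite (eq_bigr (fun=> 1)) ?sumr_const// => x _.
  by rewrite /dot big1 ?c0// => j _; rewrite mxE mul0r.
have /rV0Pn[j tj] := t0.
pose e : X := delta_mx 0 j; pose k := (t 0 j)^-1.
have dk : k * dot t e = 1.
  rewrite /dot (bigD1 j)//= big1 ?addr0 ?mxE ?eqxx ?mulr1 ?mulVf// => i ij.
  by rewrite mxE eqxx (negbTE ij) mulr0.
set S := LHS.
have S1 : S = \sum_(x : X) c (dot t x + 1).
  rewrite /S (reindex_inj (addIr (k *: e)))/=.
  by apply: eq_bigr => x _; rewrite dotDZr dk.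
have S2 : S = \sum_(x : X) c (dot t x - 1).
  rewrite /S (reindex_inj (addIr (- k *: e)))/=.
  by apply: eq_bigr => x _; rewrite dotDZr mulNr dk.
have : 2 * (S * (1 - c 1)) = 0.
  rewrite mulrBr mulr1 mulrBr mulr_natl mulr2n {1}S1 {1}S2 -big_split/=.
  under eq_bigr do rewrite cDB.
  by rewrite -mulr_sumr -mulr_suml subrr.
move/eqP; rewrite !mulf_eq0 pnatr_eq0/= subr_eq0 (eq_sym 1) (negbTE c1) orbF.
by move/eqP.
Qed.

(** After the product formula for [c], only the pairs [u = t] and [u = - t]
survive orthogonality, each with weight one half. *)
Lemma sum_cosine_sqr (T : {set X}) :
  \sum_(x : X) (\sum_(t in T) c (dot t x)) ^+ 2 <= (#|X| * #|T|)%:R.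
Proof.
have -> : \sum_(x : X) (\sum_(t in T) c (dot t x)) ^+ 2 =
  2^-1 * \sum_(t in T) \sum_(u in T)
     (\sum_(x : X) c (dot (t + u) x) + \sum_(x : X) c (dot (t - u) x)).
  rewrite mulr_sumr; under [RHS]eq_bigr do rewrite mulr_sumr.
  under [LHS]eq_bigr do rewrite expr2 big_distrlr/=.
  rewrite exchange_big; apply: eq_bigr => t _.
  rewrite exchange_big; apply: eq_bigr => u _.
  rewrite -big_split mulr_sumr; apply: eq_bigr => x _ /=.
  by rewrite dotDl dotBl cDB mulKf// pnatr_eq0.
rewrite ler_pdivrMl ?ltr0n// natrM mulrA mulr_natr.
rewrite -[leRHS]mulr_natl -sumr_const mulr_suml big_mkcond/=.
rewrite [leRHS]big_mkcond/=; apply: ler_sum => t _; case: ifP => // _.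
rewrite mul1r big_split/= mulr_natl mulr2n.
have one (f : X -> X) (a : X) : (forall u, (f u == 0) = (u == a)) ->
    \sum_(u in T) \sum_(x : X) c (dot (f u) x) <= (#|X|)%:R.
  move=> fa; under eq_bigr do rewrite sum_cosine_dot fa.
  rewrite -big_mkcondr/= (le_trans (y := \sum_(u | u == a) #|X|%:R))//.
    rewrite big_mkcond [leRHS]big_mkcond/= ler_sum// => u _.
    by case: (u == a); rewrite ?andbF// andbT; case: ifP.
  by rewrite big_pred1_eq.
apply: lerD; [apply: (one _ (- t)) => u|apply: (one _ t) => u].
  by rewrite addr_eq0 eq_sym eqr_oppLR.
by rewrite subr_eq0 eq_sym.
Qed.

(** Let [g x] be the sum of [c (t . x)] over [t] in [T], and [h x] the number of
[k] with [x + k a] in [U]. As [g] is constant along [a], the correlation of [h]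
and [g] is [#|F|] times the sum of [g] over [U], where every value is at least
[#|T| / 2]. On the other hand [sum_cosine_sqr] makes [g] small in mean square,
and [h] never exceeds the number of [k] such that [k a] is a difference of two
points of [U]; comparing through the Cauchy-Schwarz inequality bounds that
number from below. *)
Lemma transference (a : X) (T U : {set X}) :
  {in T, forall t, dot t a = 0} ->
  {in T & U, forall t x, 2^-1 <= c (dot t x)} ->
  (#|T| * #|U| * #|F| <=
   4 * (#|X| * #|[set k : F | [exists x in U, (x + k *: a)%R \in U]]|))%N.
Proof.
move=> Ta TU; set V := [set k | _].
have [->|[x0 x0U]] := set_0Vmem U; first by rewrite cards0 muln0.
pose g x := \sum_(t in T) c (dot t x).
pose W x := [set k : F | (x + k *: a)%R \in U].
pose h x : R := #|W x|%:R.
have hE x : h x = \sum_(k : F) (x + k *: a \in U)%:R.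
  rewrite /h -sum1_card natr_sum big_mkcond/=.
  by apply: eq_bigr => k _; rewrite inE; case: ifP.
have gD x k : g (x + k *: a) = g x.
  by apply: eq_bigr => t tT; rewrite dotDZr Ta// mulr0 addr0.
have hV x : h x <= #|V|%:R.
  rewrite ler_nat; have [->|[k0]] := set_0Vmem (W x); first by rewrite cards0.
  rewrite inE => xk0; rewrite -(card_imset _ (addIr (- k0))).
  apply/subset_leq_card/fintype.subsetP => _ /imsetP[k + ->].
  rewrite !inE => xk.
  apply/existsP; exists (x + k0 *: a); rewrite xk0/= -addrA -scalerDl.
  by rewrite (addrC k0) subrK.
have sum_orbit (f : X -> R) : (forall x k, f (x + k *: a) = f x) ->
    \sum_(x : X) h x * f x = #|F|%:R * \sum_(x in U) f x.
  move=> fD; under eq_bigr do rewrite hE mulr_suml.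
  rewrite exchange_big/= -sumr_const mulr_suml; apply: eq_bigr => k _.
  rewrite mul1r [RHS]big_mkcond/= [RHS](reindex_inj (addIr (k *: a)))/=.
  by apply: eq_bigr => x _; rewrite fD; case: ifP; rewrite ?mul1r ?mul0r.
have sum_h : \sum_(x : X) h x = #|F|%:R * #|U|%:R.
  have := sum_orbit (fun=> 1) (fun _ _ => erefl).
  by rewrite sumr_const; under eq_bigr do rewrite mulr1.
have gU : #|U|%:R * #|T|%:R / 2 <= \sum_(x in U) g x.
  rewrite -mulrA -sumr_const mulr_suml; apply: ler_sum => x xU.
  rewrite mul1r -sumr_const mulr_suml; apply: ler_sum => t tT.
  by rewrite mul1r TU.
have U0 : 0 < #|U|%:R :> R by rewrite ltr0n; apply/card_gt0P; exists x0.
have F0 : 0 < #|F|%:R :> R by rewrite ltr0n; apply/card_gt0P; exists 0.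
have X0 : 0 < #|X|%:R :> R by rewrite ltr0n; apply/card_gt0P; exists 0.
(* Cauchy-Schwarz is used in the form 2 y h g <= h ^ 2 + y ^ 2 g ^ 2; this [y] is
   the ratio of the lower bound for the correlation to the bound for the square
   mean of [g], which balances the two terms. *)
pose y : R := #|F|%:R * #|U|%:R / (2 * #|X|%:R).
have y0 : 0 < y by rewrite divr_gt0 ?mulr_gt0.
have : 2 * y * (\sum_(x : X) h x * g x) <=
    #|V|%:R * (\sum_(x : X) h x) + y ^+ 2 * \sum_(x : X) g x ^+ 2.
  rewrite !mulr_sumr -big_split/=; apply: ler_sum => x _.
  have : h x * h x <= #|V|%:R * h x by rewrite ler_wpM2r ?hV// /h ler0n.
  by have := sqr_ge0 (h x - y * g x); lra.
rewrite sum_orbit// sum_h => main.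
have := sum_cosine_sqr T; rewrite -/g natrM => g2.
have {main} main : 2 * y * (#|F|%:R * (#|U|%:R * #|T|%:R / 2)) <=
    #|V|%:R * (#|F|%:R * #|U|%:R) + y ^+ 2 * (#|X|%:R * #|T|%:R).
  apply: (@le_trans _ _ (2 * y * (#|F|%:R * \sum_(x in U) g x))).
    by rewrite ler_pM2l ?(mulr_gt0 _ y0)// ler_pM2l.
  by apply: (le_trans main); rewrite lerD2l ler_wpM2l ?sqr_ge0.
have Ey : y ^+ 2 * (#|X|%:R * #|T|%:R) =
    y * (#|F|%:R * (#|U|%:R * #|T|%:R / 2)).
  by rewrite expr2 {2}/y; field; rewrite gt_eqF.
rewrite Ey in main.
have {main} : y * #|T|%:R <= 2 * #|V|%:R.
  rewrite -(ler_pM2r (mulr_gt0 F0 U0)); lra.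
rewrite /y mulrAC ler_pdivrMr ?mulr_gt0// => main.
rewrite -(ler_nat R) !natrM; lra.
Qed.
End transference.

(** * Cosines as real characters modulo a prime *)

Section cosine_mod_p.
Variables (R : realType) (p : nat).
Hypothesis p_prime : prime p.

Definition cosZ (z : int) : R := cos (pi *+ 2 * z%:~R / p%:R).
Definition cosF (x : 'F_p) : R := cosZ (x : nat).

Let p0 : 0 < p%:R :> R. Proof. by rewrite ltr0n prime_gt0. Qed.

Lemma cosZDB (u v : int) : cosZ (u + v) + cosZ (u - v) = 2 * (cosZ u * cosZ v).
Proof.
rewrite /cosZ rmorphD rmorphB/= mulrDr mulrBr mulrDl mulrBl cosD cosB.
by rewrite addrACA addNr addr0 mulr_natl mulr2n.
Qed.

Lemma cosZ_period (u k : int) : cosZ (u + k * p) = cosZ u.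
Proof.
have per v m : cosZ (v + m%:Z * p) = cosZ v.
  rewrite /cosZ rmorphD rmorphM/= mulrDr mulrDl mulrA mulfK ?gt_eqF//.
  by rewrite mulr_natr periodicn//; exact: cosD2pi.
case: (intP k) => [|m|m]; [exact: (per u 0%N)|exact: (per u m.+1)|].
by rewrite -(per _ m.+1) mulNr subrK.
Qed.

(** [cosF] is defined on least residues; periodicity makes it computable from any
integer representative, which is how smallness of a scalar product is used. *)
Lemma cosFE (z : int) : cosF z%:~R = cosZ z.
Proof.
have p0Z : p%:Z != 0 by rewrite eqz_nat -lt0n prime_gt0.
have -> : z%:~R = (`|(z %% p)%Z|)%:R :> 'F_p.
  rewrite {1}(divz_eq z p) rmorphD rmorphM/= -[p%:~R]/(p%:R).
  by rewrite pchar_Fp_0// mulr0 add0r pmulrn gez0_abs// modz_ge0.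
rewrite /cosF val_Fp_nat// modn_small; last first.
  by rewrite -ltz_nat gez0_abs ?modz_ge0// ltz_pmod// ltz_nat prime_gt0.
by rewrite gez0_abs ?modz_ge0// [in RHS](divz_eq z p) addrC cosZ_period.
Qed.

Lemma cosFDB u v : cosF (u + v) + cosF (u - v) = 2 * (cosF u * cosF v).
Proof.
have E (x : 'F_p) : x = ((x : nat)%:Z)%:~R.
  apply: val_inj; rewrite -[_%:~R]/(_%:R) /= val_Fp_nat// modn_small//.
  by rewrite -[ltnRHS](Fp_cast p_prime).
by rewrite (E u) (E v) -rmorphD -rmorphB/= !cosFE cosZDB.
Qed.

Lemma cosF0 : cosF 0 = 1.
Proof. by rewrite -[cosF 0]/(cosF 0%:~R) cosFE /cosZ mulr0 mul0r cos0. Qed.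

Lemma cosF1_neq1 : cosF 1 != 1.
Proof.
rewrite -[cosF 1]/(cosF 1%:~R) cosFE /cosZ mulr1.
have pp : 0 < pi :> R := pi_gt0 R.
have [d0 d1] : (0 : R) < pi *+ 2 / p%:R /\ pi *+ 2 / p%:R <= pi :> R.
  split; first by rewrite divr_gt0// pmulrn_rgt0.
  rewrite ler_pdivrMr// -[pi *+ 2]mulr_natr ler_pM2l// ler_nat.
  exact: prime_gt1.
by rewrite lt_eqF// -[ltRHS]cos0 ltr_cos// in_itv/= ?d1 ?andbT ?lexx ltW.
Qed.

(** The angle is at most [pi / 4], so [2 cos ^ 2 - 1 = cos (2 t)] is nonnegative,
and so is [cos t]. *)
Lemma cosZ_ge_half (z : int) : (8 * `|z| <= p)%N -> 2^-1 <= cosZ z.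
Proof.
move=> zp; rewrite /cosZ; set t := _ / _.
have pp : 0 < pi :> R := pi_gt0 R.
have : `|t| <= pi / 4.
  rewrite /t normrM normfV normrM (gtr0_norm p0) ler_pdivrMr//.
  have -> : `|z%:~R| = (`|z|%N)%:R :> R by rewrite natr_absz intr_norm.
  rewrite gtr0_norm; last by rewrite pmulrn_rgt0.
  rewrite -[pi *+ 2]mulr_natr.
  move: zp; rewrite -(ler_nat R) natrM => zp.
  by rewrite -!mulrA ler_pM2l//; lra.
rewrite ler_norml => /andP[t1 t2].
have c0 : 0 <= cos t by apply: cos_ge0_pihalf; apply/andP; split; lra.
have : 0 <= cos (t *+ 2).
  by apply: cos_ge0_pihalf; rewrite -[t *+ 2]mulr_natr; apply/andP; split; lra.
rewrite cos_mulr2n -[_ *+ 2]mulr_natr => c1.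
by rewrite leNgt; apply/negP => c2; nra.
Qed.
End cosine_mod_p.

(** * Numerators for fixed denominators *)

Lemma Fp_nat_inj p (i k : nat) : prime p -> (i < p)%N -> (k < p)%N ->
  i%:R = k%:R :> 'F_p -> i = k.
Proof.
by move=> pp ip kp /(congr1 val); rewrite /= !val_Fp_nat// !modn_small.
Qed.

Lemma leq_prodn (I : finType) (F G : I -> nat) :
  (forall i, F i <= G i)%N -> (\prod_i F i <= \prod_i G i)%N.
Proof. by move=> FG; elim/big_ind2 : _ => // *; exact: leq_mul. Qed.

(** The constant 8 n is chosen so that a scalar product of n terms, each the
product of a number below h and one up to the window, stays within p / 8, where
cosines modulo p are at least 1/2. *)
Definition window (p n h : nat) : nat := p %/ (8 * n * h).

Definition small_residues (p k : nat) : {set 'F_p} :=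
  [set (i : nat)%:R | i : 'I_k.+1]%SET.

Section fixed_denominators.
Variables (R : realType) (p n N : nat).
Hypotheses (p_prime : prime p) (n_gt0 : (0 < n)%N).
Variables (H : 'I_n -> nat) (b : 'rV['F_p]_n).
Hypotheses (H_gt0 : forall j, (0 < H j)%N) (Hp : forall j, (H j <= p)%N).
Variable S : {set {ffun 'I_n -> 'I_N}}.
Hypothesis S_lt : {in S, forall (s : {ffun 'I_n -> 'I_N}) j, (s j < H j)%N}.
Hypothesis S_eq : {in S &, forall s t : {ffun 'I_n -> 'I_N},
  \sum_j ((s j : nat)%:R - (t j : nat)%:R) * b 0 j = 0}.

Let K j := window p n (H j).

Let KH j : (8 * n * (H j * K j) <= p)%N.
Proof. by rewrite mulnA mulnC leq_trunc_div. Qed.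

Let Kp j : (K j < p)%N.
Proof.
rewrite ltn_Pdiv ?prime_gt0//.
by have := H_gt0 j; nia.
Qed.

Let card_small j : #|small_residues p (K j)| = (K j).+1.
Proof.
rewrite card_imset ?card_ord// => i k /Fp_nat_inj ik; apply/val_inj/ik => //.
  by rewrite (leq_trans _ (Kp j)).
by rewrite (leq_trans _ (Kp j)).
Qed.

Let rowf (f : {ffun 'I_n -> 'F_p}) : 'rV['F_p]_n := \row_j f j.

Let rowf_inj : injective rowf.
Proof.
by move=> f g /rowP fg; apply/ffunP => j; have := fg j; rewrite !mxE.
Qed.

Let U : {set 'rV['F_p]_n} :=
  [set rowf f | f in family (fun j => small_residues p (K j))]%SET.

(** Transference applied to the differences [s - s0] of elements of [S], which are
orthogonal to [b], and to the box [U] of vectors with small residues. The box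
has at least [p ^ n] divided by the product of the [8 n H_j] points. The field [R] only
hosts the cosines. *)
Lemma card_numerators_le_dual :
  (#|S| * p <= 4 * (8 * n) ^ n * \prod_j H j *
    #|[set k : 'F_p | [forall j, [exists x in small_residues p (K j),
        [exists y in small_residues p (K j), (k * b 0 j == y - x)%R]]]]|)%N.
Proof.
set V := [set k | _].
have [->|[s0 s0S]] := set_0Vmem S; first by rewrite cards0.
pose d (s : {ffun 'I_n -> 'I_N}) : 'rV['F_p]_n :=
  \row_j ((s j : nat)%:R - (s0 j : nat)%:R).
pose T := [set d s | s in S]%SET.
have cT : #|T| = #|S|.
  rewrite card_in_imset// => s t sS tS /rowP st; apply/ffunP => j.
  apply/val_inj/(@Fp_nat_inj p) => //.
  - exact: leq_trans (S_lt sS j) (Hp j).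
  - exact: leq_trans (S_lt tS j) (Hp j).
  - by have := st j; rewrite !mxE => /addIr.
have cU : #|U| = (\prod_j (K j).+1)%N.
  rewrite card_imset// card_family foldrE big_map enumT.
  by apply: eq_bigr => j _; rewrite card_small.
have Tb : {in T, forall t, dot t b = 0}.
  move=> _ /imsetP[s sS ->]; rewrite /dot -[RHS](S_eq sS s0S).
  by apply: eq_bigr => j _; rewrite mxE.
(* The scalar product is the residue of an integer of size at most [p / 8]. *)
have TU : {in T & U, forall t x, 2^-1 <= @cosF R p (dot t x)}.
  move=> _ _ /imsetP[s sS ->] /imsetP[f /familyP fK ->].
  have /fin_all_exists[i fi] j : exists i : 'I_(K j).+1, f j = (i : nat)%:R.
    by have /imsetP[i _ ->] := fK j; exists i.
  have -> : dot (d s) (rowf f) =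
      (\sum_j ((s j : nat)%:Z - (s0 j : nat)%:Z) * (i j : nat)%:Z)%:~R.
    rewrite /dot rmorph_sum; apply: eq_bigr => j _.
    by rewrite !mxE fi rmorphM rmorphB.
  rewrite cosFE//; apply: cosZ_ge_half => //.
  rewrite -(leq_pmul2l n_gt0) -[X in (_ <= X * _)%N]card_ord -sum_nat_const.
  apply: (@leq_trans (\sum_(j < n) 8 * n * (H j * K j))%N).
    rewrite mulnA [(n * 8)%N]mulnC -big_distrr/= leq_mul2l; apply/orP; right.
    elim/big_ind2 : _ => [//|x x' y y' xx' yy'|j _].
      rewrite -lez_nat PoszD !abszE (le_trans (ler_normD _ _))//.
      by rewrite lerD// -abszE lez_nat.
    rewrite abszM leq_mul//; last exact: (ltn_ord (i j)).
    have := S_lt sS j; have := S_lt s0S j; lia.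
  by apply: leq_sum => j _; exact: KH.
have := transference (@cosFDB R p p_prime) (@cosF0 R p p_prime)
  (@cosF1_neq1 R p p_prime) Tb TU.
rewrite card_mx mul1n card_Fp// cT cU => main.
have VW : (#|[set k : 'F_p | [exists x in U, (x + k *: b)%R \in U]]| <= #|V|)%N.
  apply/subset_leq_card/fintype.subsetP => k; rewrite !inE.
  case/existsP => x /andP[/imsetP[f /familyP fK ->]] /imsetP[g /familyP gK E].
  apply/forallP => j; apply/existsP; exists (f j); rewrite fK/=.
  apply/existsP; exists (g j); rewrite gK/=; apply/eqP.
  by move/rowP/(_ j) : E; rewrite !mxE => <-; rewrite addrAC subrr add0r.
(* Each factor [p] is at most [8 n H_j] times the number of small residues. *)
have pK : (p ^ n <= (8 * n) ^ n * \prod_j H j * \prod_j (K j).+1)%N.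
  rewrite -[X in ((8 * n) ^ X)%N]card_ord -[X in (p ^ X)%N]card_ord.
  rewrite -!prod_nat_const -!big_split; apply: leq_prodn => j /=.
  by rewrite mulnC ltnW// ltn_ceil// ?muln_gt0 ?n_gt0 ?H_gt0.
have P0 : (0 < p ^ n)%N by rewrite expn_gt0 prime_gt0.
rewrite -(leq_pmul2l P0).
rewrite -(mulnA 4); set L := ((8 * n) ^ n * _)%N in pK *.
apply: (@leq_trans (L * (#|S| * (\prod_j (K j).+1) * p))%N).
  rewrite [leqRHS](_ : _ = L * (\prod_j (K j).+1) * (#|S| * p))%N; last by ring.
  by rewrite leq_mul2r pK orbT.
apply: leq_trans (leq_mul (leqnn L) main) _.
by rewrite (mulnCA L) (mulnCA L) (mulnCA 4) !mulnA leq_mul2l VW orbT.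
Qed.
End fixed_denominators.

(** * Summation over the denominators *)

Section dual_multipliers.
Variables (p N : nat).
Hypothesis p_prime : prime p.

Definition multipliers (h k : nat) (z : 'F_p) : {set 'I_N} :=
  [set r : 'I_N | (r < h)%N && [exists x in small_residues p k,
    [exists y in small_residues p k, z == r.+1%:R * (y - x)]]].

(** Since [h * k < p], the integer [r * (y - x)] is recovered from [z]: it is the
least residue of [z] if it is nonnegative, and otherwise its opposite is the
least residue of [- z]. *)
Lemma card_multipliers h k z : (h * k < p)%N ->
  (#|multipliers h k z| <=
   ndivisors_upto h (z : nat) + ndivisors_upto h (- z : nat)%R)%N.
Proof.
move=> hk; rewrite cardE -(size_map (fun r : 'I_N => r.+1)) -size_cat.
apply: uniq_leq_size.
  by rewrite map_inj_uniq ?enum_uniq// => i j [] /val_inj.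
move=> r /mapP[i]; rewrite mem_enum inE => /andP[ih].
case/existsP=> _ /andP[/imsetP[x _ ->]].
case/existsP=> _ /andP[/imsetP[y _ ->]] /eqP zE ->.
rewrite mem_cat !mem_filter !mem_index_iota !ltnS ih/= !andbT.
have key (w : 'F_p) (u v : 'I_k.+1) : (v <= u)%N ->
    w = i.+1%:R * ((u : nat)%:R - (v : nat)%:R) -> (i.+1 %| (w : nat))%N.
  move=> vu ->; rewrite -natrB// -natrM val_Fp_nat// modn_small ?dvdn_mulr//.
  rewrite (leq_ltn_trans _ hk)// leq_mul// (leq_trans (leq_subr _ _))//.
  by rewrite -ltnS.
apply/orP; have [xy|/ltnW yx] := leqP x y; [left|right].
  exact: (key z _ _ xy).
by apply: (key (- z) _ _ yx); rewrite zE -mulrN opprB.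
Qed.
End dual_multipliers.

Lemma prod_leq_sum_exp n (u : 'I_n -> nat) : (0 < n)%N ->
  (\prod_j u j <= \sum_j u j ^ n)%N.
Proof.
case: n u => // n u _; pose i := [arg max_(i > ord0) u i].
have ui j : (u j <= u i)%N by rewrite /i; case: arg_maxnP => // m _; apply.
apply: (@leq_trans (\prod_(j < n.+1) u i)); first exact: leq_prodn.
by rewrite prod_nat_const card_ord (bigD1 i)//= leq_addr.
Qed.

Section divisor_moment_mod_p.
Variables (R : realFieldType) (p n : nat).
Hypotheses (p_prime : prime p) (n_gt0 : (0 < n)%N).

(** The residue 0 has to be treated apart: it is divisible by everything and
contributes [h ^ n], which [p] absorbs. *)
Lemma divisor_moment_Fp h : (0 < h)%N -> (h ^ n <= p)%N ->
  (\sum_(z : 'F_p) (ndivisors_upto h (z : nat) +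
     ndivisors_upto h (- z : nat)%R) ^ n)%:R
  <= 2 ^+ n.+2 * p%:R * harmonic R h ^+ (2 ^ n - 1).
Proof.
move=> h0 hp; set m := (2 ^ n - 1)%N; set E := harmonic R h.
have E1 : 1 <= E.
  by rewrite /E /harmonic big_nat_recl//= invr1 lerDl sumr_ge0.
have dup : (\sum_(z : 'F_p) (ndivisors_upto h (z : nat) +
     ndivisors_upto h (- z : nat)%R) ^ n <=
     2 ^ n.+1 * \sum_(z : 'F_p) ndivisors_upto h (z : nat) ^ n)%N.
  rewrite expnS mulnAC mulnC mulSn mul1n mulnDr.
  rewrite [X in (_ <= _ + 2 ^ n * X)%N](reindex_inj oppr_inj)/=.
  rewrite !big_distrr/= -big_split/=; apply: leq_sum => z _.
  rewrite -!expnMn; set u := ndivisors_upto _ _; set v := ndivisors_upto _ _.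
  have [uv|/ltnW vu] := leqP u v.
    by rewrite (leq_trans _ (leq_addl _ _))// leq_exp2r//; lia.
  by rewrite (leq_trans _ (leq_addr _ _))// leq_exp2r//; lia.
apply: (@le_trans _ _ (2 ^+ n.+1 * (2 * (p%:R * E ^+ m)))); last first.
  by rewrite [in leRHS]exprS; lra.
move: dup; rewrite -(ler_nat R) natrM natrX => dup.
apply: (le_trans dup); rewrite ler_wpM2l ?exprn_ge0//.
have -> : (\sum_(z : 'F_p) ndivisors_upto h (z : nat) ^ n =
    \sum_(0 <= x < p) ndivisors_upto h x ^ n)%N.
  by rewrite -(big_mkord xpredT (fun x => ndivisors_upto h x ^ n)%N) Fp_cast.
have pp := prime_gt0 p_prime.
rewrite big_ltn// natrD mulr_natl mulr2n lerD//.
  apply: (@le_trans _ _ p%:R); last first.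
    by rewrite ler_peMr// exprn_ege1.
  rewrite ler_nat (leq_trans _ hp)//.
  rewrite leq_exp2r// /ndivisors_upto.
  rewrite (leq_trans (size_subseq (filter_subseq _ _)))//.
  by rewrite size_iota subn1.
rewrite natr_sum; under eq_bigr do rewrite natrX.
have := ndivisors_upto_moment R h n p.-1; rewrite prednK// => /le_trans; apply.
by rewrite ler_wpM2r ?exprn_ge0 ?harmonic_ge0// ler_nat leq_pred.
Qed.
End divisor_moment_mod_p.

Section count_mod_p.
Variables (R : realType) (p n N : nat).
Hypotheses (p_prime : prime p) (n_gt0 : (0 < n)%N).
Hypotheses (Np : (N < p)%N) (Nnp : (N ^ n <= p)%N).
Variables (H : 'I_n -> nat) (a : 'I_n -> 'F_p).
Hypotheses (H_gt0 : forall j, (0 < H j)%N) (HN : forall j, (H j <= N)%N).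
Hypothesis a_neq0 : forall j, a j != 0.
Local Notation tup := {ffun 'I_n -> 'I_N}.
Variable Q : {set tup * tup}.
Hypothesis Q_lt : {in Q, forall rs : tup * tup,
  forall j, (rs.1 j < H j)%N && (rs.2 j < H j)%N}.
Hypothesis Q_eq : forall r s t : tup, (r, s) \in Q -> (r, t) \in Q ->
  \sum_j ((s j : nat)%:R - (t j : nat)%:R) * (a j / (r j).+1%:R) = 0.

Let K j := window p n (H j).

Let mult j z := multipliers N (H j) (K j) (z : 'F_p).

Let D : {set tup} := [set r : tup | [forall j, (r j < H j)%N]].

Let dual (r : tup) := [set k : 'F_p | [forall j,
  [exists x in small_residues p (K j), [exists y in small_residues p (K j),
    k * (\row_i (a i / (r i).+1%:R)) 0 j == y - x]]]].

(** Only denominators of the box contribute; the sum keeps this restriction, which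
later makes the divisors that are counted for the index [j] at most [H j]. *)
Let count_dual :
  (#|Q| * p <= 4 * (8 * n) ^ n * \prod_j H j * \sum_(r in D) #|dual r|)%N.
Proof.
pose S r := [set s | (r, s) \in Q].
have -> : #|Q| = (\sum_(r in D) #|S r|)%N.
  rewrite -sum1_card (eq_bigl (fun rs => (rs.1 \in D) && (rs.2 \in S rs.1))).
    rewrite -(pair_big_dep (mem D) (fun r s => s \in S r) (fun _ _ => 1%N))/=.
    by apply: eq_bigr => r _; rewrite sum1_card.
  case=> r s; rewrite !inE/=; apply/idP/andP => [rsQ|[]//].
  by split=> //; apply/forallP => j; have /andP[] := Q_lt rsQ j.
rewrite big_distrl big_distrr/=; apply: leq_sum => r _.
apply: (@card_numerators_le_dual R) => //.
- by move=> j; rewrite (leq_trans (HN j))// ltnW.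
- by move=> s; rewrite inE => /Q_lt rsQ j; have /andP[] := rsQ j.
- move=> s t; rewrite !inE => rs rt; rewrite -[RHS](Q_eq rs rt).
  by apply: eq_bigr => j _; rewrite mxE.
Qed.

(** For fixed [k] the conditions on the different [r_j] are independent, which
gives the product of the [#|mult j (k a_j)|]. Replacing it by a sum of [n]-th
powers decouples the indices, and multiplication by [a_j] then permutes the
residues. *)
Let sum_dual :
  (\sum_(r in D) #|dual r| <= \sum_j \sum_(z : 'F_p) #|mult j z| ^ n)%N.
Proof.
have -> : (\sum_(r in D) #|dual r| =
    \sum_(k : 'F_p) #|[set r in D | k \in dual r]|)%N.
  under eq_bigr do rewrite -sum1_card.
  rewrite (exchange_big_dep xpredT)//=; apply: eq_bigr => k _.
  by rewrite -sum1dep_card.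
have -> : (\sum_j \sum_(z : 'F_p) #|mult j z| ^ n =
    \sum_(k : 'F_p) \sum_j #|mult j (k * a j)%R| ^ n)%N.
  rewrite [RHS]exchange_big; apply: eq_bigr => j _ /=.
  by rewrite (reindex_inj (mulIf (a_neq0 j))).
apply: leq_sum => k _; apply: (leq_trans _ (prod_leq_sum_exp _ n_gt0)).
apply: (@leq_trans #|family (fun j => mult j (k * a j)%R)|); last first.
  by rewrite card_family foldrE big_map enumT.
apply/subset_leq_card/fintype.subsetP => r.
rewrite !inE => /andP[/forallP rD /forallP rk].
apply/familyP => j; rewrite inE rD/=.
have /existsP[x /andP[xK /existsP[y /andP[yK /eqP E]]]] := rk j.
apply/existsP; exists x; rewrite xK; apply/existsP; exists y; rewrite yK/=.
rewrite -E mxE mulrCA [_.+1%:R * _]mulrC divfK//.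
apply/eqP => r0; suff : (r j).+1 = 0%N by [].
apply: (Fp_nat_inj p_prime _ (prime_gt0 p_prime) r0).
by rewrite (leq_ltn_trans _ Np).
Qed.

Lemma card_solutions_mod_p :
  #|Q|%:R <= (4 * (8 * n) ^ n * n * 2 ^ n.+2)%:R * (\prod_j (H j)%:R) *
     harmonic R N ^+ (2 ^ n - 1).
Proof.
have p0 : 0 < p%:R :> R by rewrite ltr0n prime_gt0.
rewrite -(ler_pM2r p0) -natrM.
have main := leq_trans count_dual (leq_mul (leqnn _) sum_dual).
move: main; rewrite -(ler_nat R) => /le_trans; apply.
set c := (4 * (8 * n) ^ n)%N; set m := (2 ^ n - 1)%N; set E := harmonic R N.
have bound j : (\sum_(z : 'F_p) #|mult j z| ^ n)%:R <=
    2 ^+ n.+2 * p%:R * E ^+ m.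
  have hK : (H j * K j < p)%N.
    have : (8 * n * (H j * K j) <= p)%N by rewrite mulnA mulnC leq_trunc_div.
    by have := prime_gt0 p_prime; nia.
  apply: (@le_trans _ _ (2 ^+ n.+2 * p%:R * harmonic R (H j) ^+ m)).
    apply: le_trans (divisor_moment_Fp R p_prime n_gt0 (H_gt0 j) _); last first.
      by rewrite (leq_trans _ Nnp)// leq_exp2r.
    rewrite ler_nat; apply: leq_sum => z _; rewrite leq_exp2r//.
    exact: card_multipliers.
  apply: ler_wpM2l; first by rewrite mulr_ge0 ?exprn_ge0.
  apply: lerXn2r; rewrite ?nnegrE ?harmonic_ge0//.
  rewrite /E /harmonic [leRHS](@big_cat_nat _ _ _ (H j).+1)//=; last first.
    by rewrite ltnS.
  by rewrite lerDl sumr_ge0// => i _; rewrite invr_ge0.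
apply: (@le_trans _ _ ((c * \prod_j H j)%:R *
    \sum_(j < n) (2 ^+ n.+2 * p%:R * E ^+ m))).
  rewrite natrM ler_wpM2l// natr_sum; apply: ler_sum => j _; exact: bound.
rewrite sumr_const card_ord -natrX; set w := (2 ^ n.+2)%N.
rewrite -[_ *+ n]mulr_natl !natrM natr_prod le_eqVlt.
by apply/orP; left; apply/eqP; ring.
Qed.
End count_mod_p.

(** * From boxes of integers to residues, and the asymptotic form *)

Local Open Scope classical_set_scope.
Local Open Scope ring_scope.

(** The left side is an integer combination, independent of the field; this
carries the vanishing of a sum of fractions from the rationals to the field with
[p] elements. *)
Lemma sum_fractions_common_denominator (F : fieldType) n (u : 'I_n -> int)
    (d : 'I_n -> nat) : (forall j, (d j)%:R != 0 :> F) ->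
  (\sum_j u j * (\prod_(i < n | i != j) d i)%:Z)%:~R
  = (\prod_j (d j)%:R) * \sum_j (u j)%:~R / (d j)%:R :> F.
Proof.
move=> d0; rewrite rmorph_sum mulr_sumr; apply: eq_bigr => j _.
rewrite rmorphM/= -[(Posz _)%:~R]/(_%:R) natr_prod.
rewrite [X in _ = X * _](bigD1 j)//=; set P := \prod_(i < n | _) _.
by field.
Qed.

Section box_solutions.
Variables (n N : nat) (H : 'I_n -> nat) (B : 'I_n -> int) (a : 'rV[int]_n.+1).
Hypothesis HN : forall j, (H j <= N)%N.
Local Notation tup := {ffun 'I_n -> 'I_N}.

(** The solutions in finite-type coordinates: [rs.1 j] and [rs.2 j] are the
offsets of [r_j] from 1 and of [s_j] from [B j + 1]. *)
Definition box_solutions : {set tup * tup} :=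
  [set rs : tup * tup | [forall j, (rs.1 j < H j)%N && (rs.2 j < H j)%N] &&
    (\sum_j (a 0 (lift ord0 j))%:~R *
       ((B j + 1 + (rs.2 j)%:Z)%:~R / (rs.1 j).+1%:R)
     == (a 0 ord0)%:~R :> rat)].

Lemma num_frac_solutions_le :
  (num_frac_solutions a
       (int_box (fun=> 1%R) (fun j => (H j)%:Z))
       (int_box (fun j => B j + 1)%R (fun j => B j + (H j)%:Z)%R)
   <= #|box_solutions|)%N.
Proof.
pose f (rs : tup * tup) : 'rV[int]_n * 'rV[int]_n :=
  (\row_j ((rs.1 j).+1)%:Z, \row_j (B j + 1 + (rs.2 j)%:Z)).
rewrite /num_frac_solutions.
apply: (@leq_trans #|` [fset f rs | rs in box_solutions]|%fset); last first.
  by rewrite (leq_trans (leq_imfset_card _ _ _))//= cardE.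
apply: fsubset_leq_card; apply/fsubsetP => -[r s].
rewrite in_fset_set ?inE; last exact: frac_solutions_finite.
move=> [/= rB [sB E]].
have {}rB j : 1 <= r 0 j <= (H j)%:Z := rB j.
have {}sB j : B j + 1 <= s 0 j <= B j + (H j)%:Z := sB j.
have rN j : (`|(r 0 j - 1)%R| < N)%N by have := rB j; have := HN j; lia.
have sN j : (`|(s 0 j - (B j + 1))%R| < N)%N by have := sB j; have := HN j; lia.
pose r' : tup := [ffun j => Ordinal (rN j)].
pose s' : tup := [ffun j => Ordinal (sN j)].
have rE j : r 0 j = ((r' j).+1)%:Z.
  have /andP[r1 _] := rB j.
  by rewrite ffunE/= intS gez0_abs ?subr_ge0// addrC subrK.
have sE j : s 0 j = B j + 1 + (s' j)%:Z.
  have /andP[s1 _] := sB j.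
  by rewrite ffunE/= gez0_abs ?subr_ge0// addrC subrK.
apply/imfsetP; exists (r', s') => /=.
  rewrite inE/=; apply/andP; split.
    apply/forallP => j; have := rB j; have := sB j; rewrite rE sE; lia.
  by rewrite -E; apply/eqP/eq_bigr => j _; rewrite rE sE.
by congr pair; apply/rowP => j; rewrite mxE.
Qed.

Lemma box_solutions_eq_mod p (r s t : tup) : prime p -> (N < p)%N ->
  (r, s) \in box_solutions -> (r, t) \in box_solutions ->
  \sum_j ((s j : nat)%:R - (t j : nat)%:R) *
    ((a 0 (lift ord0 j))%:~R / (r j).+1%:R) = 0 :> 'F_p.
Proof.
move=> pp Np; rewrite !inE/= => /andP[_ /eqP Es] /andP[_ /eqP Et].
pose u j := a 0 (lift ord0 j) * ((s j)%:Z - (t j)%:Z).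
have uE (F : fieldType) : \sum_j ((s j : nat)%:R - (t j : nat)%:R) *
    ((a 0 (lift ord0 j))%:~R / (r j).+1%:R) =
    \sum_j (u j)%:~R / (r j).+1%:R :> F.
  apply: eq_bigr => j _; rewrite /u rmorphM rmorphB/= mulrA.
  by rewrite [X in X / _]mulrC.
rewrite uE; pose d j := (r j).+1.
have u0 : \sum_j (u j)%:~R / (d j)%:R = 0 :> rat.
  rewrite -uE -[RHS](subrr (a 0 ord0)%:~R) -{1}Es -Et -sumrB.
  apply: eq_bigr => j _; rewrite !rmorphD/=.
  have : (d j)%:R != 0 :> rat by rewrite pnatr_eq0.
  by rewrite -/(d j); move: (d j)%:R => x x0; field.
have d0 j : (d j)%:R != 0 :> 'F_p.
  apply/eqP => dj0; suff : d j = 0%N by [].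
  apply: (Fp_nat_inj pp _ (prime_gt0 pp) dj0).
  exact: leq_ltn_trans (ltn_ord (r j)) Np.
have : \sum_j u j * (\prod_(i < n | i != j) d i)%:Z = 0.
  apply: (@intr_inj rat); rewrite sum_fractions_common_denominator ?u0 ?mulr0//.
  by move=> j; rewrite pnatr_eq0.
move/(congr1 (fun z : int => z%:~R : 'F_p)).
rewrite sum_fractions_common_denominator//= => /eqP.
rewrite mulf_eq0 prodf_seq_eq0 => /orP[/hasP[j _ /= dj]|/eqP//].
by rewrite (negbTE (d0 j)) in dj.
Qed.

End box_solutions.

(** The prime of the reduction cancels out of the bound, so it can be chosen in
terms of [N] and [a]. *)
Lemma card_solutions_le (R : realType) n N (H : 'I_n -> nat) (B : 'I_n -> int)
    (a : 'rV[int]_n.+1) : (0 < n)%N ->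
  (forall j, (0 < H j)%N) -> (forall j, (H j <= N)%N) ->
  (forall j, a 0 (lift ord0 j) != 0) ->
  (num_frac_solutions a
     (int_box (fun=> 1) (fun j => (H j)%:Z))
     (int_box (fun j => B j + 1) (fun j => B j + (H j)%:Z)))%:R
  <= (4 * (8 * n) ^ n * n * 2 ^ n.+2)%:R * (\prod_j (H j)%:R) *
     harmonic R N ^+ (2 ^ n - 1).
Proof.
move=> n0 H0 HN a0.
have [p pbig p_prime] :=
  prime_above (N + N ^ n + \sum_j `|a 0%R (lift ord0 j)|)%N.
have aj0 j : (a 0 (lift ord0 j))%:~R != 0 :> 'F_p.
  have ajp : (`|a 0%R (lift ord0 j)| < p)%N.
    by move: pbig; rewrite (bigD1 j)//=; lia.
  apply/eqP => E; move: (a0 j); rewrite -absz_eq0 => /eqP; apply.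
  apply: (Fp_nat_inj p_prime) => //; first exact: prime_gt0.
  rewrite pmulrn abszE; move: E; case: ger0P => _ //.
  by rewrite mulrNz => ->; rewrite oppr0.
have Np : (N < p)%N by lia.
have Nnp : (N ^ n <= p)%N by lia.
have Q_lt : {in box_solutions N H B a,
    forall rs : {ffun 'I_n -> 'I_N} * {ffun 'I_n -> 'I_N},
    forall j, (rs.1 j < H j)%N && (rs.2 j < H j)%N}.
  by move=> rs; rewrite inE => /andP[/forallP].
apply: le_trans (@card_solutions_mod_p R p n N p_prime n0 Np Nnp H _ H0 HN aj0
  _ Q_lt (fun r s t => box_solutions_eq_mod p_prime Np)).
by rewrite ler_nat num_frac_solutions_le.
Qed.

(** Comparison of increments: [ln (1 - x) <= - x] at [x = 1 / (N + 2)]. *)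
Lemma harmonic_le_ln (R : realType) N : (0 < N)%N ->
  harmonic R N <= 1 + ln N%:R.
Proof.
case: N => // N _; elim: N => [|N IH].
  by rewrite /harmonic big_nat1 invr1 ln1 addr0.
rewrite /harmonic big_nat_recr//= -/(harmonic R N.+1).
suff gap : N.+2%:R^-1 + ln N.+1%:R <= ln N.+2%:R :> R.
  by rewrite (le_trans (lerD IH (lexx _)))// -addrA lerD2l addrC.
have N2 : N.+2%:R != 0 :> R by rewrite pnatr_eq0.
have := @le_ln1Dx R (- N.+2%:R^-1).
rewrite (_ : 1 - _ = N.+1%:R / N.+2%:R); last first.
  rewrite -[X in X - _](mulfV N2) -[X in _ - X]mul1r -mulrBl.
  by rewrite -(natrB _ (isT : (1 <= N.+2)%N)) subn1.
rewrite ln_div ?posrE ?ltr0n// ltrN2 invf_lt1 ?ltr0n// ltr1n => /(_ isT).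
by move: (N.+2%:R^-1) (ln _) (ln _) => u v w; lra.
Qed.

Lemma expR_le_ln (R : realType) (x y : R) : expR x <= y -> x <= ln y.
Proof.
move=> xy; have y0 := lt_le_trans (expR_gt0 x) xy.
by rewrite -[leLHS]expRK ler_ln ?posrE ?expR_gt0.
Qed.

(** The power of [ln N] with this exponent is the constant [expR c]. *)
Lemma cvg_div_lnln (R : realType) (c : R) :
  c / ln (ln N%:R) @[N --> \oo] --> 0.
Proof.
apply/cvgr0Pnorm_le => e e0.
near=> N.
have N1 : expR (expR (`|c| / e + 1)) <= N%:R by near: N; exact: nbhs_infty_ger.
have L1 := expR_le_ln N1.
have L2 := expR_le_ln L1.
have c0 : 0 <= `|c| / e by rewrite divr_ge0// ltW.
have L0 : 0 < ln (ln N%:R :> R) by lra.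
rewrite normrM normfV (gtr0_norm L0) ler_pdivrMr//.
by rewrite mulrC -ler_pdivrMr//; lra.
Unshelve. all: by end_near. Qed.

Theorem theorem1 (R : realType) (n : nat) (A : R) (n_ge1 : (1 <= n)%N)
    (A_gt0 : 0 < A) :
  exists2 o : nat -> R, o N @[N --> \oo] --> 0 &
  \forall N \near \oo,
    forall (H : 'I_n -> nat) (B : 'I_n -> int) (a : 'rV[int]_n.+1),
    (forall j, (0 < H j)%N) ->
    (\max_(j < n) H j)%N = N ->
    (forall j : 'I_n, 1 <= `|a 0 (lift ord0 j)| /\
       `|a 0 (lift ord0 j)|%:~R <= expR (N%:R `^ A)) ->
    (num_frac_solutions a
       (int_box (fun=> 1) (fun j => (H j)%:Z))
       (int_box (fun j => B j + 1) (fun j => B j + (H j)%:Z)))%:R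
    <= (\prod_(j < n) (H j)%:R) * ln N%:R `^ (2 ^+ n - 1 + o N).
Proof.
pose m := (2 ^ n - 1)%N.
pose c : R := (4 * (8 * n) ^ n * n * 2 ^ n.+2)%:R.
have c0 : 0 < c by rewrite ltr0n; rewrite !(muln_gt0, expn_gt0) n_ge1. 
(* The power of 2 comes from [harmonic R N <= 2 ln N]. *)
pose C := c * 2 ^+ m.
have C0 : 0 < C by rewrite mulr_gt0// exprn_gt0.
exists (fun N => ln C / ln (ln N%:R)); first exact: cvg_div_lnln.
near=> N => H B a H0 maxH a1.
have HN j : (H j <= N)%N by rewrite -maxH; exact: leq_bigmax.
(* [ln N >= 2] gives both [1 + ln N <= 2 ln N] and [ln (ln N) > 0]. *)
have N1 : expR 2 <= N%:R :> R by near: N; exact: nbhs_infty_ger.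
have L2 := expR_le_ln N1.
have N0 : (0 < N)%N by rewrite -(ltr0n R) (lt_le_trans _ N1) ?expR_gt0.
have powE : ln N%:R `^ (2 ^+ n - 1 + ln C / ln (ln N%:R)) =
    C * ln N%:R ^+ m :> R.
  have L0 : 0 < ln N%:R :> R by lra.
  have LL0 : 0 < ln (ln N%:R) :> R by rewrite ln_gt0//; lra.
  rewrite powRD; last by rewrite (gt_eqF L0) implybT.
  have -> : 2 ^+ n - 1 = m%:R :> R by rewrite natrB ?expn_gt0// natrX.
  rewrite powR_mulrn ?ltW// mulrC; congr (_ * _).
  by rewrite /powR (gt_eqF L0) divfK ?gt_eqF// lnK.
rewrite powE.
have a0 j : a 0 (lift ord0 j) != 0 by have [a1j _] := a1 j; lia.
apply: (le_trans (card_solutions_le R B n_ge1 H0 HN a0)).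
rewrite -/c -/m /C -!mulrA mulrCA.
rewrite ler_wpM2l ?prodr_ge0// ler_pM2l// -exprMn.
apply: lerXn2r; rewrite ?nnegrE ?harmonic_ge0//; first by lra.
by apply: (le_trans (harmonic_le_ln _ N0)); lra.
Unshelve. all: by end_near. Qed.
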